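(* Let $\mathfrak g$ be a complex simple Lie algebra with Cartan subalgebra $\mathfrak h$, positive roots $\Delta^+$, simple roots $\Pi$, Chevalley base $\{\mathrm x_\alpha\}_{\alpha\in\Delta}$ and coroots $\mathrm h_\alpha$, and let $\sigma$ be the associated (Kostant--Hitchin) involution of $\mathfrak g$. Let $\eta$ be the longest root. Then $$\sigma(\mathrm x_\eta)=-\mathrm x_\eta,\qquad\sigma(\mathrm h_\eta)=\mathrm h_\eta .$$ Moreover $\sigma$ globally preserves $\mathfrak g_Z$ and $\mathfrak g_{Z^\dagger}$.
   Context: A Chevalley base is a collection of non-zero vectors $\mathrm x_\alpha\in\mathfrak g_\alpha$ ($\alpha\in\Delta$) such that $[\mathrm x_\alpha,\mathrm x_{-\alpha}]=-\mathrm h_\alpha$, $[\mathrm x_\alpha,\mathrm x_\beta]=N_{\alpha,\beta}\mathrm x_{\alpha+\beta}$ with integers $N_{\alpha,\beta}$ when $\alpha+\beta\neq 0$ (with $\mathrm x_{\alpha+\beta}=0$ if $\alpha+\beta$ is not a root), and such that the antilinear map sending $\mathrm x_\alpha$ to $\mathrm x_{-\alpha}$ and each coroot $\mathrm h_\alpha$ to $-\mathrm h_\alpha$ is an antilinear automorphism $\rho$ of $\mathfrak g$. Let $a=\frac12\sum_{\alpha\in\Delta^+}\mathrm h_\alpha=\sum_{\alpha\in\Pi}r_\alpha\mathrm h_\alpha$, $X=\sum_{\alpha\in\Pi}\sqrt{r_\alpha}\,\mathrm x_\alpha$, $Y=\sum_{\alpha\in\Pi}\sqrt{r_\alpha}\,\mathrm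 x_{-\alpha}$; these span a principal subalgebra $\mathfrak s\cong\mathfrak{sl}(2,\mathbb C)$. The involution $\sigma$ is the unique complex linear Lie algebra automorphism of $\mathfrak g$ such that $\sigma=-1$ on $\mathfrak z=\ker(\operatorname{ad}(X))$ and $\sigma(Y)=-Y$; it exists, commutes with $\rho$, and preserves $\mathfrak h$. $\eta$ is the unique positive root such that $\beta+\eta$ is not a root for any positive root $\beta$; $Z^\dagger=\Pi\cup\{-\eta\}$, $Z=-Z^\dagger$, $\mathfrak g_Z=\bigoplus_{\alpha\in Z}\mathfrak g_\alpha$, $\mathfrak g_{Z^\dagger}=\bigoplus_{\alpha\in Z^\dagger}\mathfrak g_\alpha$. *)

(* Defs.v *)
(* The complex numbers are R[i], for an arbitrary R : realType. *)
From HB Require Import structures.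
From mathcomp Require Export all_boot all_order all_algebra.
From mathcomp Require Export complex reals.

Set Implicit Arguments.
Unset Strict Implicit.
Unset Printing Implicit Defensive.

Import Order.TTheory GRing.Theory Num.Theory.

Local Open Scope ring_scope.

(* Carried by a vectType, so finite dimensional. *)
HB.mixin Record Vector_isLie (F : fieldType) g of Vector F g := {
  lie : g -> g -> g;
  lie_linear_r : forall x : g, linear (lie x);
  lie_linear_l : forall y : g, linear (fun x => lie x y);
  liexx : forall x : g, lie x x = 0;
  lie_jacobi : forall x y z : g,
    lie x (lie y z) + lie y (lie z x) + lie z (lie x y) = 0
}.

#[short(type="lieAlgType")]
HB.structure Definition LieAlgebra (F : fieldType) :=
  { g of Vector_isLie F g & Vector F g }.

Notation "⁅ x , y ⁆" := (lie x y)
  (at level 0, x, y at level 99, format "⁅ x ,  y ⁆") : ring_scope.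

Section LieAlgebra.
Context {F : fieldType} {g : lieAlgType F}.

HB.instance Definition _ (x : g) :=
  GRing.isLinear.Build F g g _ (lie x) (lie_linear_r x).

Definition ad (x : g) : 'End(g) := linfun (lie x).

Lemma adE (x y : g) : ad x y = ⁅x, y⁆.
Proof. by rewrite lfunE. Qed.

Definition lie_prodv (U V : {vspace g}) : {vspace g} :=
  <<[seq ⁅u, v⁆ | u <- vbasis U, v <- vbasis V]>>%VS.

Definition lie_abelian (U : {vspace g}) : Prop :=
  forall x y, x \in U -> y \in U -> ⁅x, y⁆ = 0.

Definition lie_ideal (I : {vspace g}) : Prop :=
  forall x y : g, y \in I -> ⁅x, y⁆ \in I.

(* Over an algebraically closed field, this is semisimplicity. *)
Definition diagonalizable_end (f : 'End(g)) : Prop :=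
  exists s : seq F, (\sum_(c <- s) passmx.leigenspace f c)%VS = fullv.

(* A maximal abelian subalgebra all of whose elements are ad-semisimple: the
   usual definition of a Cartan subalgebra of a semisimple Lie algebra over an
   algebraically closed field of characteristic 0. *)
Definition cartan_subalgebra (h : {vspace g}) : Prop :=
  [/\ lie_abelian h,
      forall U : {vspace g}, lie_abelian U -> (h <= U)%VS -> U = h
    & forall x, x \in h -> diagonalizable_end (ad x)].

Definition lie_automorphism (s : 'End(g)) : Prop :=
  bijective s /\ forall x y : g, s ⁅x, y⁆ = ⁅s x, s y⁆.

End LieAlgebra.

Notation dual_of h := 'Hom(subvs_of h, _^o).

Section Roots.
Context {F : fieldType} {g : lieAlgType F} {h : {vspace g}}.

Definition rootspace (alpha : dual_of h) : {vspace g} :=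
  (\bigcap_(H <- vbasis {: subvs_of h})
     passmx.leigenspace (ad (vsval H)) (alpha H))%VS.

Definition is_root : pred (dual_of h) :=
  [pred alpha | (alpha != 0) && (rootspace alpha != 0%VS)].

Definition is_coroot (alpha : dual_of h) (H : subvs_of h) : Prop :=
  vsval H \in lie_prodv (rootspace alpha) (rootspace (- alpha))
  /\ alpha H = 2%:R.

(* Dp enumerates, without repetition, a positive system: it contains exactly
   one of each pair of opposite roots and is closed under addition of roots. *)
Definition positive_roots (Dp : seq (dual_of h)) : Prop :=
  [/\ uniq Dp,
      {in Dp, forall alpha, is_root alpha},
      forall alpha, is_root alpha -> (alpha \in Dp) (+) (- alpha \in Dp)
    & {in Dp &, forall alpha beta,
         is_root (alpha + beta) -> alpha + beta \in Dp}].

Definition simple_roots (Dp : seq (dual_of h)) : seq (dual_of h) :=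
  [seq alpha <- Dp |
     ~~ has (fun beta => has (fun gamma => alpha == beta + gamma) Dp) Dp].

Definition longest_root (Dp : seq (dual_of h)) (eta : dual_of h) : Prop :=
  eta \in Dp /\ {in Dp, forall beta, ~~ is_root (beta + eta)}.

Definition Zdagger (Dp : seq (dual_of h)) (eta : dual_of h) : seq (dual_of h) :=
  - eta :: simple_roots Dp.

Definition Zroots (Dp : seq (dual_of h)) (eta : dual_of h) : seq (dual_of h) :=
  [seq - alpha | alpha <- Zdagger Dp eta].

Definition rootspace_sum (S : seq (dual_of h)) : {vspace g} :=
  (\sum_(alpha <- S) rootspace alpha)%VS.

End Roots.

Definition lie_simple (F : fieldType) (g : lieAlgType F) : Prop :=
  (exists x y : g, ⁅x, y⁆ != 0)
  /\ forall I : {vspace g}, lie_ideal I -> I = 0%VS \/ I = fullv.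

Lemma memv_rootspace (F : fieldType) (g : lieAlgType F) (h : {vspace g})
    (alpha : dual_of h) (x : g) :
  x \in rootspace alpha <->
  forall H : subvs_of h, ⁅vsval H, x⁆ = (alpha H : F) *: x.
Proof.
have mem_leig (H : subvs_of h) c :
    (x \in passmx.leigenspace (ad (vsval H)) c) = (⁅vsval H, x⁆ == c *: x).
  rewrite memv_ker add_lfunE opp_lfunE scale_lfunE id_lfunE adE.
  by rewrite subr_eq0.
have capP (s : seq (subvs_of h)) (f : subvs_of h -> {vspace g}) :
    x \in (\bigcap_(H <- s) f H)%VS <-> forall H, H \in s -> x \in f H.
  elim: s => [|H s IHs]; first by rewrite big_nil memvf.
  rewrite big_cons memv_cap; split=> [/andP[xH /IHs xs] K|xs].
    by rewrite inE => /predU1P[->|/xs].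
  rewrite xs ?mem_head //=; apply/IHs => K Ks.
  by apply: xs; rewrite inE Ks orbT.
rewrite /rootspace capP; split=> [eig H|eig H _]; last first.
  by rewrite mem_leig eig.
rewrite (coord_vbasis (memvf H)) linear_sum.
set b := vbasis _.
have lieD (K : 'I_(\dim {: subvs_of h}) -> g) : ⁅\sum_i K i, x⁆ = \sum_i ⁅K i, x⁆.
  have D u v : ⁅u + v, x⁆ = ⁅u, x⁆ + ⁅v, x⁆.
    by have := lie_linear_l x 1 u v; rewrite /= !scale1r.
  have Z0 : ⁅0, x⁆ = 0 by apply: (addrI ⁅0, x⁆); rewrite -D !addr0.
  by elim/big_rec2: _ => [//|i u v _ <-]; rewrite D.
rewrite lieD linear_sum scaler_suml; apply: eq_bigr => i _.
rewrite !linearZ /=.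
have := lie_linear_l x (coord b i H) (vsval b`_i) 0.
have Z0 : ⁅0, x⁆ = 0.
  apply: (addrI ⁅0, x⁆); rewrite addr0.
  by have := lie_linear_l x 1 0 0; rewrite /= !scale1r addr0.
rewrite /= !addr0 Z0 addr0 => ->.
have /eig : b`_i \in b by rewrite mem_nth // size_tuple.
by rewrite mem_leig => /eqP ->; rewrite scalerA.
Qed.

Section Chevalley.
Context {R : realType} {g : lieAlgType R[i]} {h : {vspace g}}.

Definition antilinear_automorphism (rho : g -> g) : Prop :=
  [/\ bijective rho,
      forall (c : R[i]) (u v : g), rho (c *: u + v) = c^* *: rho u + rho v
    & forall u v : g, rho ⁅u, v⁆ = ⁅rho u, rho v⁆].

(* Only the values of x and hc at the roots matter. *)
Record chevalley_base (x : dual_of h -> g) (hc : dual_of h -> subvs_of h)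
  : Prop := ChevalleyBase {
  chev_mem : forall alpha, is_root alpha -> x alpha \in rootspace alpha;
  chev_neq0 : forall alpha, is_root alpha -> x alpha != 0;
  chev_coroot : forall alpha, is_root alpha -> is_coroot alpha (hc alpha);
  chev_opp : forall alpha, is_root alpha ->
    ⁅x alpha, x (- alpha)⁆ = - vsval (hc alpha);
  chev_int : exists N : dual_of h -> dual_of h -> int,
    forall alpha beta, is_root alpha -> is_root beta -> alpha + beta != 0 ->
      ⁅x alpha, x beta⁆ =
        (N alpha beta)%:~R *:
          (if is_root (alpha + beta) then x (alpha + beta) else 0);
  chev_rho : exists2 rho : g -> g, antilinear_automorphism rho &
    forall alpha, is_root alpha ->
      rho (x alpha) = x (- alpha)
      /\ rho (vsval (hc alpha)) = - vsval (hc alpha)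
}.

Variables (Dp : seq (dual_of h)) (x : dual_of h -> g)
  (hc : dual_of h -> subvs_of h) (r : dual_of h -> R[i]).

(* Determines r on the simple roots, where its values are positive reals; so
   sqrtC below is the usual square root. *)
Definition principal_coefficients : Prop :=
  2%:R^-1 *: (\sum_(alpha <- Dp) hc alpha)
    = \sum_(alpha <- simple_roots Dp) r alpha *: hc alpha.

Definition principal_X : g :=
  \sum_(alpha <- simple_roots Dp) sqrtC (r alpha) *: x alpha.

Definition principal_Y : g :=
  \sum_(alpha <- simple_roots Dp) sqrtC (r alpha) *: x (- alpha).

Definition kostant_hitchin_involution (sigma : 'End(g)) : Prop :=
  [/\ lie_automorphism sigma,
      {in lker (ad principal_X), forall z, sigma z = - z}
    & sigma principal_Y = - principal_Y].

End Chevalley.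

(* Main.v *)
(* Put A = 1/2 sum_{alpha > 0} h_alpha.  Reflecting in a root beta cancels the
   terms of sum_{alpha > 0} beta(h_alpha) except for those alpha > 0 made negative
   by the reflection, where beta(h_alpha) > 0: so beta(A) > 0 for beta > 0, and
   beta(A) = 1 for beta simple, since then only alpha = beta survives.  Hence ad A
   grades g by height, [A, X] = X, [A, Y] = -Y and [X, Y] = -A; as sigma negates X
   and Y it fixes A and preserves the sums of the root spaces of height 1 and -1,
   i.e. of the simple roots and of their opposites.  The space g_eta is killed by
   ad X, so sigma = -1 on it.  The space g_{-eta} is killed by ad Y, and on it
   (ad X)^(2 ht eta) is injective, commutes with sigma and has values in
   ker (ad X), so sigma = -1 there too. *)
From HB Require Import structures.
Require Import Defs.
From mathcomp Require Import all_boot all_order all_algebra.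
From mathcomp Require Import complex reals.
From mathcomp Require Import ring.

Set Implicit Arguments.
Unset Strict Implicit.
Unset Printing Implicit Defensive.

Import Order.TTheory GRing.Theory Num.Theory.
Local Open Scope ring_scope.

Lemma memv_sum_ind (F : fieldType) (V : vectType F) (I : eqType)
    (U : I -> {vspace V}) (P : V -> Prop) (s : seq I) :
  P 0 -> (forall u v, P u -> P v -> P (u + v)) ->
  (forall i v, i \in s -> v \in U i -> P v) ->
  forall v, v \in (\sum_(i <- s) U i)%VS -> P v.
Proof.
move=> P0 PD; elim: s => [|i s IHs] Ps v.
  by rewrite big_nil memv0 => /eqP ->.
rewrite big_cons => /memv_addP[u ui [w ws ->]]; apply: PD.
  by apply: Ps ui; rewrite mem_head.
by apply: IHs ws => j z js; apply: Ps; rewrite inE js orbT.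
Qed.

Lemma memv_sum_seq (F : fieldType) (V : vectType F) (I : eqType)
    (U : I -> {vspace V}) (s : seq I) i v :
  i \in s -> v \in U i -> v \in (\sum_(i <- s) U i)%VS.
Proof.
elim: s => // j s IHs; rewrite inE big_cons => /predU1P[-> vj|/IHs h /h vs].
  by rewrite -[v]addr0 memv_add ?mem0v.
by rewrite -[v]add0r memv_add ?mem0v.
Qed.

Lemma perm_map_self (T : eqType) (s : seq T) (f : T -> T) :
  uniq s -> {in s &, injective f} -> {in s, forall u, f u \in s} ->
  perm_eq (map f s) s.
Proof.
move=> us fi fs; have um : uniq (map f s) by rewrite map_inj_in_uniq.
have sub : {subset map f s <= s} by move=> _ /mapP[u /fs ? ->].
apply: uniq_perm => //.
by have [] := uniq_min_size um sub _; rewrite ?size_map.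
Qed.

(** * Eigenvectors of adjoint operators *)

Section LieTheory.
Context {F : fieldType} {g : lieAlgType F}.
Implicit Types x y z H v : g.

Lemma lieDl y : {morph (fun x => ⁅x, y⁆) : u v / u + v}.
Proof. by move=> u v; have := lie_linear_l y 1 u v; rewrite /= !scale1r. Qed.

Lemma lie0l y : ⁅0, y⁆ = 0.
Proof. by apply: (addrI ⁅0, y⁆); rewrite -lieDl !addr0. Qed.

Lemma lieZl c x y : ⁅c *: x, y⁆ = c *: ⁅x, y⁆.
Proof.
by have := lie_linear_l y c x 0; rewrite /= !addr0 lie0l addr0.
Qed.

Lemma lieNl x y : ⁅- x, y⁆ = - ⁅x, y⁆.
Proof. by rewrite -scaleN1r lieZl scaleN1r. Qed.

Lemma lieZr c x y : ⁅x, c *: y⁆ = c *: ⁅x, y⁆.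
Proof. exact: linearZ. Qed.

Lemma lieNr x y : ⁅x, - y⁆ = - ⁅x, y⁆.
Proof. exact: linearN. Qed.

Lemma lie_sumr (I : Type) (s : seq I) (f : I -> g) x :
  ⁅x, \sum_(i <- s) f i⁆ = \sum_(i <- s) ⁅x, f i⁆.
Proof. exact: linear_sum. Qed.

Lemma lie_suml (I : Type) (s : seq I) (f : I -> g) y :
  ⁅\sum_(i <- s) f i, y⁆ = \sum_(i <- s) ⁅f i, y⁆.
Proof. by elim/big_rec2: _ => [|i u v _ <-]; rewrite ?lie0l ?lieDl. Qed.

Lemma lie_anti x y : ⁅x, y⁆ = - ⁅y, x⁆.
Proof.
apply/eqP; rewrite -addr_eq0; have := liexx (x + y).
by rewrite lieDl !linearD /= !liexx add0r addr0 => ->.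
Qed.

Lemma lie_der x y z : ⁅x, ⁅y, z⁆⁆ = ⁅⁅x, y⁆, z⁆ + ⁅y, ⁅x, z⁆⁆.
Proof.
have := lie_jacobi x y z.
rewrite (lie_anti z x) linearN /= (lie_anti z ⁅x, y⁆) => /eqP.
by rewrite subr_eq0 subr_eq addrC => /eqP ->; rewrite addrC.
Qed.

(* The operator \prod_(c <- s) (ad H - c). *)
Definition ad_prod H (s : seq F) v : g := foldr (fun c u => ⁅H, u⁆ - c *: u) v s.

Lemma ad_prodD H s : {morph ad_prod H s : u v / u + v}.
Proof.
by move=> u v; elim: s => //= c s ->; rewrite linearD /= scalerDr opprD addrACA.
Qed.

Lemma ad_prodZ H s k v : ad_prod H s (k *: v) = k *: ad_prod H s v.
Proof.
elim: s => //= c s ->; rewrite linearZ /= scalerBr; congr (_ - _).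
by rewrite !scalerA mulrC.
Qed.

Lemma ad_prod0 H s : ad_prod H s 0 = 0.
Proof. by rewrite -[in LHS](scale0r 0) ad_prodZ scale0r. Qed.

Lemma ad_prod_eigen H s c v : ⁅H, v⁆ = c *: v ->
  ad_prod H s v = (\prod_(b <- s) (c - b)) *: v.
Proof.
move=> Hv; elim: s => [|b s IHs] /=; first by rewrite big_nil scale1r.
by rewrite IHs big_cons linearZ /= Hv !scalerA -scalerBl mulrBl mulrC.
Qed.

Lemma memv_leigenspace H c v :
  (v \in passmx.leigenspace (ad H) c) = (⁅H, v⁆ == c *: v).
Proof.
rewrite memv_ker add_lfunE opp_lfunE scale_lfunE id_lfunE adE.
by rewrite subr_eq0.
Qed.

Lemma diagonalizable_ad_prod H : diagonalizable_end (ad H) ->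
  exists2 s, uniq s & forall v, ad_prod H s v = 0.
Proof.
case=> s sT; exists (undup s); first exact: undup_uniq.
move=> v; have : v \in fullv by rewrite memvf.
rewrite -sT; move: v; apply: memv_sum_ind => [|u v u0 v0|c v cs].
- exact: ad_prod0.
- by rewrite ad_prodD u0 v0 addr0.
rewrite memv_leigenspace => /eqP /ad_prod_eigen->; apply/eqP.
rewrite scaler_eq0; apply/orP; left.
by rewrite prodf_seq_eq0; apply/hasP; exists c; rewrite /= ?mem_undup ?subrr ?eqxx.
Qed.

Lemma ad_prod_eigenvectors H s (W U : {vspace g}) :
  uniq s -> (forall v, v \in W -> ⁅H, v⁆ \in W) ->
  (forall c v, v \in W -> ⁅H, v⁆ = c *: v -> v \in U) ->
  forall v, v \in W -> ad_prod H s v = 0 -> v \in U.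
Proof.
move=> us HW HU; elim: s us => [_ v _ /= ->|c s IHs /= /andP[cs us] v vW].
  exact: mem0v.
move=> /eqP; rewrite subr_eq0 => /eqP eig.
set u := ad_prod H s v in eig; set k := \prod_(b <- s) (c - b).
have k0 : k != 0.
  rewrite prodf_seq_neq0; apply/allP => b bs /=.
  by rewrite subr_eq0; apply: contraNneq cs => ->.
have uW : u \in W.
  rewrite /u; elim: (s) => //= b t IHt.
  by rewrite memvB ?memvZ ?HW.
rewrite -[v](subrK (k^-1 *: u)) memvD ?memvZ ?(HU c u) //.
apply: IHs => //; first by rewrite memvB ?memvZ.
rewrite -scaleNr ad_prodD ad_prodZ (ad_prod_eigen _ eig) -/u -/k.
by rewrite scalerA mulNr mulVf // scaleN1r subrr.
Qed.

Lemma joint_eigenvectors (Hs : seq g) (W U : {vspace g}) :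
  {in Hs &, forall H K, ⁅H, K⁆ = 0} ->
  {in Hs, forall H, diagonalizable_end (ad H)} ->
  {in Hs, forall H v, v \in W -> ⁅H, v⁆ \in W} ->
  (forall v, v \in W -> {in Hs, forall H, exists c, ⁅H, v⁆ = c *: v} ->
     v \in U) ->
  (W <= U)%VS.
Proof.
elim: Hs W => [|H Hs IHs] W HC Hd HW HU.
  by apply/subvP => v vW; apply: HU.
have [s us sH] := diagonalizable_ad_prod (Hd H (mem_head _ _)).
apply/subvP => v vW.
apply: (ad_prod_eigenvectors us (HW H (mem_head _ _)) _ vW (sH v)).
move=> c {vW}v vW Hv.
pose W' := (W :&: passmx.leigenspace (ad H) c)%VS.
suff /subvP : (W' <= U)%VS by apply; rewrite memv_cap vW memv_leigenspace Hv /=.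
have sub K : K \in Hs -> K \in H :: Hs by rewrite inE orbC => ->.
apply: IHs => [K L Ks Ls|K Ks|K Ks u|u].
- by apply: HC; apply: sub.
- by apply: Hd; apply: sub.
- rewrite !memv_cap !memv_leigenspace => /andP[uW /eqP Hu].
  rewrite HW ?sub //= lie_der (HC H K) ?mem_head ?sub // lie0l add0r Hu.
  by rewrite linearZ /=.
rewrite memv_cap memv_leigenspace => /andP[uW /eqP Hu] eu.
apply: HU => // K; rewrite inE => /predU1P[->|/eu //].
by exists c.
Qed.

End LieTheory.

(** * Representations of sl(2) *)

Record sl2_triple (F : fieldType) (g : lieAlgType F) (e f k : g) : Prop :=
  Sl2Triple {
  sl2_ef : ⁅e, f⁆ = k;
  sl2_ke : ⁅k, e⁆ = 2%:R *: e;
  sl2_kf : ⁅k, f⁆ = - 2%:R *: f;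
  sl2_weights : exists s : seq F, forall c v, ⁅k, v⁆ = c *: v -> v != 0 -> c \in s
}.

Section Sl2.
Context {F : numFieldType} {g : lieAlgType F}.
Implicit Types (e f k v : g).

Lemma sl2_weight_iter (d : F) e k v (c : F) n :
  ⁅k, e⁆ = d *: e -> ⁅k, v⁆ = c *: v ->
  ⁅k, iter n (lie e) v⁆ = (c + d * n%:R) *: iter n (lie e) v.
Proof.
move=> ke kv; elim: n => [|n IHn] /=; first by rewrite mulr0 addr0.
rewrite lie_der ke IHn lieZl linearZ /= -scalerDl; congr (_ *: _).
by rewrite -addn1 natrD; ring.
Qed.

Lemma sl2_opp e f k : sl2_triple e f k -> sl2_triple f e (- k).
Proof.
move=> [ef ke kf [s ks]]; split.
- by rewrite lie_anti ef.
- by rewrite lieNl kf scaleNr opprK.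
- by rewrite lieNl ke scaleNr.
exists (map -%R s) => c v kv v0; rewrite -[c]opprK map_f //.
by apply: ks v0; rewrite scaleNr -kv lieNl opprK.
Qed.

Lemma sl2_nilpotent e f k c v : sl2_triple e f k -> ⁅k, v⁆ = c *: v ->
  exists n, iter n (lie e) v = 0.
Proof.
move=> [_ ke _ [s ks]] kv.
pose w n := c + 2%:R * n%:R.
have [/allP ws|/allPn[b /mapP[n _ ->] bs]] :=
  boolP (all [in s] (map w (iota 0 (size s).+1))).
  have /uniq_leq_size : uniq (map w (iota 0 (size s).+1)).
    rewrite map_inj_uniq ?iota_uniq // => m n /addrI.
    by move=> /(mulfI (_ : 2%:R != 0)); rewrite pnatr_eq0 => /(_ isT) /eqP;
       rewrite eqr_nat => /eqP.
  by move=> /(_ _ ws); rewrite size_map size_iota ltnn.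
exists n; apply/eqP; apply: contraNT bs; apply: ks.
exact: sl2_weight_iter.
Qed.

Lemma sl2_commute e f k c v n : sl2_triple e f k -> ⁅k, v⁆ = c *: v ->
  ⁅e, iter n.+1 (lie f) v⁆
    = iter n.+1 (lie f) ⁅e, v⁆ + (n.+1%:R * (c - n%:R)) *: iter n (lie f) v.
Proof.
move=> [ef _ kf _] kv; elim: n => [|n IHn].
  by rewrite /= lie_der ef kv mul1r subr0 addrC.
rewrite [iter n.+2 _ v]iterS lie_der ef (sl2_weight_iter n.+1 kf kv) IHn.
rewrite linearD linearZ /= -/(iter n.+1 _ _) addrCA -scalerDl; congr (_ + _ *: _).
by rewrite -[n.+2]addn1 -[n.+1]addn1 !natrD; ring.
Qed.

Lemma iter_lie0 e n : iter n (lie e) 0 = 0.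
Proof. by elim: n => //= n ->; rewrite linear0. Qed.

Lemma sl2_highest_neq0 e f k c v n : sl2_triple e f k -> ⁅k, v⁆ = c *: v ->
  ⁅e, v⁆ = 0 -> v != 0 -> (forall m, (m < n)%N -> c != m%:R) ->
  iter n (lie f) v != 0.
Proof.
move=> tr kv ev v0; elim: n => //= n IHn cn.
apply/eqP => fn; have := sl2_commute n tr kv.
rewrite /= fn ev iter_lie0 !linear0 add0r => /esym/eqP; rewrite scaler_eq0.
rewrite (negPf (IHn _)) ?orbF => [|m mn]; last by rewrite cn // ltnS ltnW.
by rewrite mulf_eq0 pnatr_eq0 subr_eq0 (negPf (cn n _)).
Qed.

(* Induction on the least p with e^p v = 0: [e, v] has weight n + 2 and is
   killed by f^(n+2), hence is 0, so v is a highest weight vector. *)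
Lemma sl2_lower_inj e f k v n : sl2_triple e f k -> ⁅k, v⁆ = n%:R *: v ->
  iter n (lie f) v = 0 -> v = 0.
Proof.
move=> tr kv; have [p] := sl2_nilpotent tr kv.
elim: p n v kv => [|p IHp] n v kv //; rewrite iterSr => ep fn.
have kev : ⁅k, ⁅e, v⁆⁆ = n.+2%:R *: ⁅e, v⁆.
  have := sl2_weight_iter 1 (sl2_ke tr) kv.
  by rewrite /= mulr1 -natrD addn2.
have ev : ⁅e, v⁆ = 0.
  apply: (IHp n.+2) => //.
  have := sl2_commute n.+1 tr kv.
  have fn1 : iter n.+1 (lie f) v = 0 by rewrite iterS fn linear0.
  by rewrite [X in ⁅e, X⁆]iterS fn1 !linear0 addr0 => <-.
apply: contra_eq fn => v0; apply: sl2_highest_neq0 tr kv ev v0 _ => m mn.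
by rewrite eqr_nat gtn_eqF.
Qed.

Lemma sl2_weight_nat e f k c v : sl2_triple e f k -> ⁅k, v⁆ = c *: v ->
  ⁅e, v⁆ = 0 -> v != 0 -> exists n, c = n%:R.
Proof.
move=> tr kv ev v0; have kv' : ⁅- k, v⁆ = (- c) *: v by rewrite lieNl kv scaleNr.
have [n fn] := sl2_nilpotent (sl2_opp tr) kv'.
have [/allP cn|/allPn[m _]] := boolP (all (fun m => c != m%:R) (iota 0 n)).
  have := @sl2_highest_neq0 _ _ _ _ _ n tr kv ev v0; rewrite fn eqxx => h.
  by have /h : forall m, (m < n)%N -> c != m%:R
    by move=> m mn; apply: cn; rewrite mem_iota.
by rewrite negbK => /eqP ->; exists m.
Qed.

Lemma sl2_weight_int e f k c v : sl2_triple e f k -> ⁅k, v⁆ = c *: v ->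
  v != 0 -> exists z : int, c = z%:~R.
Proof.
move=> tr kv v0; have /ex_minnP[[|p]] : exists p, iter p (lie e) v == 0.
- by have [p /eqP] := sl2_nilpotent tr kv; exists p.
- by rewrite (negPf v0).
move=> /eqP ep min.
have v0' : iter p (lie e) v != 0.
  by apply/negP => /min; rewrite ltnn.
have [n cn] := sl2_weight_nat tr (sl2_weight_iter p (sl2_ke tr) kv) ep v0'.
exists (n%:Z - 2 * p%:Z); rewrite rmorphB rmorphM /= -!pmulrn -cn.
by rewrite addrK.
Qed.

End Sl2.

(** * Roots and reflections *)

Section WeightValue.
Context {F : fieldType} {g : lieAlgType F} {h : {vspace g}}.
Implicit Types (alpha beta : dual_of h) (H K : subvs_of h).

(* Typed in F rather than in the regular module F^o. *)
Definition wt alpha H : F := alpha H.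

Lemma wtD alpha beta H : wt (alpha + beta) H = wt alpha H + wt beta H.
Proof. by rewrite /wt add_lfunE. Qed.

Lemma wtN alpha H : wt (- alpha) H = - wt alpha H.
Proof. by rewrite /wt opp_lfunE. Qed.

Lemma wt0 H : wt 0 H = 0.
Proof. by rewrite /wt zero_lfunE. Qed.

Lemma wtZ c alpha H : wt (c *: alpha) H = c * wt alpha H.
Proof. by rewrite /wt scale_lfunE. Qed.

Lemma wtB alpha beta H : wt (alpha - beta) H = wt alpha H - wt beta H.
Proof. by rewrite wtD wtN. Qed.

Lemma wtNr alpha H : wt alpha (- H) = - wt alpha H.
Proof. by rewrite /wt linearN. Qed.

Lemma wtZr alpha c H : wt alpha (c *: H) = c * wt alpha H.
Proof. by rewrite /wt linearZ. Qed.

Lemma wt_sumr alpha (I : Type) (s : seq I) (f : I -> subvs_of h) :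
  wt alpha (\sum_(i <- s) f i) = \sum_(i <- s) wt alpha (f i).
Proof. by rewrite /wt linear_sum. Qed.

Lemma lie_rootspace alpha H y :
  y \in rootspace alpha -> ⁅vsval H, y⁆ = wt alpha H *: y.
Proof. by move/memv_rootspace; apply. Qed.

Lemma lie_vsvalZ c H y : ⁅vsval (c *: H), y⁆ = c *: ⁅vsval H, y⁆.
Proof. by rewrite linearZ lieZl. Qed.

Lemma lie_in_rootspace alpha beta y z :
  y \in rootspace alpha -> z \in rootspace beta ->
  ⁅y, z⁆ \in rootspace (alpha + beta).
Proof.
move=> ya zb; apply/memv_rootspace => H; rewrite -/(wt _ _) wtD lie_der.
by rewrite (lie_rootspace H ya) (lie_rootspace H zb) lieZl linearZ -scalerDl.
Qed.

Lemma rootspace_nonroot alpha y :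
  alpha != 0 -> ~~ is_root alpha -> y \in rootspace alpha -> y = 0.
Proof.
by move=> a0 /nandP[/negP[] //|/negPn/eqP ->]; rewrite memv0 => /eqP.
Qed.

Lemma root_neq0 alpha : is_root alpha -> alpha != 0.
Proof. by case/andP. Qed.

Lemma root_of_rootspace alpha y :
  alpha != 0 -> y \in rootspace alpha -> y != 0 -> is_root alpha.
Proof.
by move=> a0 ya; apply: contraR => /(rootspace_nonroot a0)/(_ ya) ->.
Qed.

Context (hC : cartan_subalgebra h).

Lemma cartan_commute H K : ⁅vsval H, vsval K⁆ = 0.
Proof. by case: hC => hA _ _; apply: hA; apply: subvsP. Qed.

Lemma cartan_weights H :
  exists s : seq F, forall c v, ⁅vsval H, v⁆ = c *: v -> v != 0 -> c \in s.
Proof.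
case: hC => _ _ /(_ _ (subvsP H))/diagonalizable_ad_prod[s _ sk].
exists s => c v kv v0; have /eqP := sk v; rewrite (ad_prod_eigen _ kv).
rewrite scaler_eq0 (negPf v0) orbF prodf_seq_eq0 => /hasP[b bs].
by rewrite /= subr_eq0 => /eqP ->.
Qed.

Lemma rootspace0 y : y \in rootspace (0 : dual_of h) -> y \in h.
Proof.
move=> y0; have hy (H : g) : H \in h -> ⁅H, y⁆ = 0.
  by move=> Hh; rewrite -(vsprojK Hh) (lie_rootspace _ y0) wt0 scale0r.
case: hC => hA max _; rewrite -(max (h + <[y]>)%VS) ?addvSl //.
  by apply: subvP (addvSr _ _) _ (memv_line _).
move=> a b /memv_addP[u uh [_ /vlineP[c ->] ->{a}]].
move=> /memv_addP[v vh [_ /vlineP[d ->] ->{b}]].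
rewrite lieDl !linearD /= !linearZ /= !lieZl (hA _ _ uh vh) liexx (hy _ uh).
by rewrite lie_anti (hy _ vh) oppr0 !scaler0 !addr0.
Qed.

Lemma weight_decomposition (U : {vspace g}) :
  (forall alpha, (rootspace alpha <= U)%VS) -> U = fullv.
Proof.
move=> sU; apply/eqP; rewrite eqEsubv subvf /=; case: hC => hA _ hD.
pose b := vbasis (fullv : {vspace subvs_of h}).
apply: (@joint_eigenvectors _ _ (map vsval b)).
- by move=> _ _ /mapP[H _ ->] /mapP[K _ ->]; apply: cartan_commute.
- by move=> _ /mapP[H _ ->]; apply/hD/subvsP.
- by move=> *; rewrite memvf.
move=> v _ eig.
have [c cE] : exists c : 'I_(\dim {: subvs_of h}) -> F,
    forall i, ⁅vsval b`_(i : 'I_ _), v⁆ = c i *: v.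
  have ex (i : 'I_(\dim {: subvs_of h})) : exists c, ⁅vsval b`_i, v⁆ = c *: v.
    by apply/eig/map_f/mem_nth; rewrite size_tuple.
  exact: fin_all_exists ex.
pose al (H : subvs_of h) : F^o := \sum_i coord b i H * c i.
have al_lin : linear al.
  move=> k H K; rewrite /al /GRing.scale /= mulr_sumr -big_split /=.
  by apply: eq_bigr => i _; rewrite linearD linearZ /= mulrDl mulrA.
pose al' : {linear subvs_of h -> F^o} :=
  HB.pack al (GRing.isLinear.Build _ _ _ _ al al_lin).
apply: (subvP (sU (linfun al'))); apply/memv_rootspace => H.
rewrite lfunE /= {1}(coord_vbasis (memvf H)) linear_sum lie_suml scaler_suml.
by apply: eq_bigr => i _; rewrite linearZ lieZl /= cE scalerA.
Qed.
End WeightValue.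

(* The part of a Chevalley base that is used, over an arbitrary field. *)
Record sl2_system (F : fieldType) (g : lieAlgType F) (h : {vspace g})
    (x : dual_of h -> g) (hc : dual_of h -> subvs_of h) : Prop := Sl2System {
  sl2s_mem : forall alpha, is_root alpha -> x alpha \in rootspace alpha;
  sl2s_neq0 : forall alpha, is_root alpha -> x alpha != 0;
  sl2s_coroot : forall alpha, is_root alpha -> is_coroot alpha (hc alpha);
  sl2s_opp : forall alpha, is_root alpha ->
    ⁅x alpha, x (- alpha)⁆ = - vsval (hc alpha)
}.

Section RootTheory.
Context {F : numFieldType} {g : lieAlgType F} {h : {vspace g}}.
Context {x : dual_of h -> g} {hc : dual_of h -> subvs_of h}.
Context (hC : cartan_subalgebra h) (hX : sl2_system x hc).
Implicit Types (alpha beta gamma : dual_of h) (H K : subvs_of h).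

Lemma wt_coroot alpha : is_root alpha -> wt alpha (hc alpha) = 2%:R.
Proof. by move/(sl2s_coroot hX) => []. Qed.

Lemma root_opp alpha : is_root alpha -> is_root (- alpha).
Proof.
move=> ra; have [hm] := sl2s_coroot hX ra => h2.
apply/andP; split; first by rewrite oppr_eq0 root_neq0.
apply: contraTneq hm => ->; apply/negP.
rewrite /lie_prodv; have -> : vbasis (0%VS : {vspace g}) = [::] :> seq g.
  by apply: size0nil; rewrite size_tuple dimv0.
rewrite allpairs0r span_nil memv0 => /eqP hc0.
have h0 : hc alpha = 0 by apply: subvs_inj; rewrite hc0 linear0.
by move: h2; rewrite h0 linear0 => /esym/eqP; rewrite (pnatr_eq0 F 2).
Qed.

Lemma coroot_opp alpha : is_root alpha -> hc (- alpha) = - hc alpha.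
Proof.
move=> ra; apply: subvs_inj; rewrite [RHS]linearN /=.
rewrite -[LHS]opprK -(sl2s_opp hX (root_opp ra)) opprK lie_anti opprK.
exact: (sl2s_opp hX ra).
Qed.

Lemma sl2_root alpha : is_root alpha ->
  sl2_triple (x alpha) (- x (- alpha)) (vsval (hc alpha)).
Proof.
move=> ra; have rN := root_opp ra; split.
- by rewrite linearN /= (sl2s_opp hX ra) opprK.
- by rewrite (lie_rootspace _ (sl2s_mem hX ra)) wt_coroot.
- rewrite linearN /= (lie_rootspace _ (sl2s_mem hX rN)) wtN wt_coroot //.
  by rewrite scalerN.
exact: cartan_weights.
Qed.

Lemma root_vector gamma : is_root gamma ->
  exists2 y, y \in rootspace gamma & y != 0.
Proof.
by move=> rg; exists (x gamma); [apply: (sl2s_mem hX)|apply: (sl2s_neq0 hX)].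
Qed.

Lemma iter_rootspace beta gamma e y k :
  e \in rootspace beta -> y \in rootspace gamma ->
  iter k (lie e) y \in rootspace (gamma + beta *+ k).
Proof.
move=> eb yg; elim: k => [|k IHk]; first by rewrite mulr0n addr0.
by rewrite iterS mulrS addrCA lie_in_rootspace.
Qed.

Lemma neg_root_vector beta : is_root beta -> - x (- beta) \in rootspace (- beta).
Proof. by move=> rb; rewrite memvN; apply (sl2s_mem hX (root_opp rb)). Qed.

Lemma root_string beta gamma n k : is_root beta -> is_root gamma ->
  wt gamma (hc beta) = n%:R -> (k <= n)%N -> gamma - beta *+ k != 0 ->
  is_root (gamma - beta *+ k).
Proof.
move=> rb rg gn kn g0; have [y yg y0] := root_vector rg.
have ky := lie_rootspace (hc beta) yg; rewrite gn in ky.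
pose f := - x (- beta).
apply: (root_of_rootspace (y := iter k (lie f) y)) => //.
  by rewrite -mulNrn iter_rootspace // neg_root_vector.
apply: contra_neq y0 => fk; apply: sl2_lower_inj (sl2_root rb) ky _.
by rewrite -(subnK kn) iterD -/f fk iter_lie0.
Qed.

Lemma cartan_integer beta gamma : is_root beta -> is_root gamma ->
  exists z : int, wt gamma (hc beta) = z%:~R.
Proof.
move=> rb rg; have [y yg y0] := root_vector rg.
exact: sl2_weight_int (sl2_root rb) (lie_rootspace (hc beta) yg) y0.
Qed.

(* A vector y of weight 2 beta has coroot weight 4, so [f^4 y] must not vanish;
   but [f^2 y] lies in h, hence [f^3 y] is a multiple of f. *)
Lemma double_nonroot beta : is_root beta -> ~~ is_root (beta *+ 2).
Proof.
move=> rb; apply/negP => r2; have [y yg y0] := root_vector r2.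
have ky := lie_rootspace (hc beta) yg.
rewrite mulr2n wtD wt_coroot // -natrD in ky.
pose f := - x (- beta); have fb := neg_root_vector rb.
have : iter 2 (lie f) y \in h.
  apply: (rootspace0 hC); have := iter_rootspace 2 fb yg.
  by rewrite mulNrn subrr.
move=> f2h; case/eqP: y0; apply: sl2_lower_inj (sl2_root rb) ky _.
rewrite -/f iterD -(vsprojK f2h) /= -/f.
by rewrite [⁅f, vsval _⁆]lie_anti (lie_rootspace _ fb) linearN linearZ /= liexx
           scaler0 oppr0.
Qed.

Definition reflection beta gamma := gamma - wt gamma (hc beta) *: beta.

Lemma wt_refl beta gamma : is_root beta ->
  wt (reflection beta gamma) (hc beta) = - wt gamma (hc beta).
Proof. by move=> rb; rewrite wtB wtZ wt_coroot //; ring. Qed.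

Lemma reflK beta gamma : is_root beta ->
  reflection beta (reflection beta gamma) = gamma.
Proof. by move=> rb; rewrite {1}/reflection wt_refl // scaleNr opprK subrK. Qed.

Lemma refl_opp_root beta gamma : is_root beta ->
  reflection (- beta) gamma = reflection beta gamma.
Proof.
by move=> rb; rewrite /reflection coroot_opp // wtNr scalerN scaleNr opprK.
Qed.

Lemma root_refl beta gamma : is_root beta -> is_root gamma ->
  is_root (reflection beta gamma).
Proof.
wlog : beta / exists n : nat, wt gamma (hc beta) = n%:R => [hwlog rb rg|[n gn]].
  have [[n|n] gz] := cartan_integer rb rg; first by apply: hwlog => //; exists n.
  rewrite -refl_opp_root //; apply: hwlog => //; last exact: root_opp.
  by exists n.+1; rewrite coroot_opp // wtNr gz NegzE rmorphN opprK.
move=> rb rg; rewrite /reflection gn scaler_nat.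
apply: (root_string rb rg gn (leqnn n)).
rewrite -scaler_nat -gn -/(reflection _ _); apply: contraTneq (root_neq0 rg) => r0.
by rewrite -(reflK gamma rb) r0 /reflection wt0 scale0r subr0 eqxx.
Qed.
End RootTheory.

(** * Heights *)

Section PositiveSystem.
Context {F : numFieldType} {g : lieAlgType F} {h : {vspace g}}.
Context {x : dual_of h -> g} {hc : dual_of h -> subvs_of h}.
Context {Dp : seq (dual_of h)}.
Context (hC : cartan_subalgebra h) (hX : sl2_system x hc).
Context (hP : positive_roots Dp).
Implicit Types (alpha beta gamma zeta : dual_of h) (H K : subvs_of h).
Local Notation refl := (@reflection _ _ _ hc).

Definition all_roots := Dp ++ map -%R Dp.

Lemma pos_uniq : uniq Dp. Proof. by case: hP. Qed.

Lemma pos_root alpha : alpha \in Dp -> is_root alpha.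
Proof. by case: hP => _ h2 _ _; apply: h2. Qed.

Lemma pos_opp alpha : alpha \in Dp -> - alpha \notin Dp.
Proof.
by case: hP => _ h2 h3 _ ad; have := h3 _ (h2 _ ad); rewrite ad /=.
Qed.

Lemma pos_or_opp alpha : is_root alpha -> alpha \notin Dp -> - alpha \in Dp.
Proof. by case: hP => _ _ h3 _ /h3; case: (alpha \in Dp). Qed.

Lemma pos_add alpha beta : alpha \in Dp -> beta \in Dp ->
  is_root (alpha + beta) -> alpha + beta \in Dp.
Proof. by case: hP => _ _ _; apply. Qed.

Lemma pos_add_neq0 alpha beta : alpha \in Dp -> beta \in Dp -> alpha + beta != 0.
Proof.
move=> ad /pos_opp; apply: contraNneq => /eqP.
by rewrite addr_eq0 => /eqP <-.
Qed.

Lemma mem_all_roots alpha : (alpha \in all_roots) = is_root alpha.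
Proof.
rewrite mem_cat; apply/orP/idP => [[/pos_root //|/mapP[b /pos_root rb ->]]|ra].
  exact: (root_opp hX).
have [|aD] := boolP (alpha \in Dp); first by left.
by right; rewrite -[alpha]opprK map_f // pos_or_opp.
Qed.

Lemma uniq_all_roots : uniq all_roots.
Proof.
rewrite cat_uniq pos_uniq map_inj_uniq ?pos_uniq ?andbT /=; last exact: oppr_inj.
by apply/hasPn => _ /mapP[b bd ->]; apply: pos_opp.
Qed.

(* The Killing form of h, except that each root counts only once. *)
Definition root_form H K : F := \sum_(zeta <- all_roots) wt zeta H * wt zeta K.

Lemma root_formC H K : root_form H K = root_form K H.
Proof. by apply: eq_bigr => zeta _; rewrite mulrC. Qed.

(* Proportional to 1 / (alpha, alpha). *)
Definition half_norm alpha : F := 2^-1 * root_form (hc alpha) (hc alpha).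

Lemma sum_refl (f : dual_of h -> F) beta : is_root beta ->
  \sum_(zeta <- all_roots) f (refl beta zeta) = \sum_(zeta <- all_roots) f zeta.
Proof.
move=> rb; rewrite -(big_map (refl beta) predT); apply: perm_big.
apply: (perm_map_self uniq_all_roots) => [|zeta]; last first.
  by rewrite !mem_all_roots; apply: (root_refl hC hX rb).
exact: in2W (can_inj (fun zeta => reflK hX zeta rb)).
Qed.

(* Averaging the sum over the reflection in alpha. *)
Lemma root_form_coroot alpha H : is_root alpha ->
  root_form (hc alpha) H = half_norm alpha * wt alpha H.
Proof.
move=> ra; rewrite /half_norm.
have : root_form (hc alpha) H =
    - root_form (hc alpha) H + root_form (hc alpha) (hc alpha) * wt alpha H.
  rewrite {1}/root_form -(sum_refl _ ra) /root_form mulr_suml -sumrN -big_split /=.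
  apply: eq_bigr => zeta _; rewrite (wt_refl hX _ ra) wtB wtZ; ring.
move=> e; apply: (mulfI (_ : 2%:R != 0 :> F)); rewrite ?pnatr_eq0 //.
rewrite -mulrA mulVKf ?pnatr_eq0 // mulr2n mulrDl mul1r {1}e.
by rewrite addrAC addNr add0r.
Qed.

Lemma half_norm_gt0 alpha : is_root alpha -> 0 < half_norm alpha.
Proof.
move=> ra; rewrite mulr_gt0 ?invr_gt0 ?ltr0n // /root_form.
rewrite (bigD1_seq alpha) ?uniq_all_roots ?mem_all_roots //= (wt_coroot hX ra).
apply: ltr_pwDl; first by rewrite -natrM ltr0n.
rewrite big_seq_cond; apply: sumr_ge0 => zeta /andP[]; rewrite mem_all_roots => rz _.
have [z ->] := cartan_integer hC hX ra rz.
by rewrite -rmorphM /= ler0z -expr2 sqr_ge0.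
Qed.

Lemma half_norm_sym alpha beta : is_root alpha -> is_root beta ->
  half_norm alpha * wt alpha (hc beta) = half_norm beta * wt beta (hc alpha).
Proof. by move=> ra rb; rewrite -!root_form_coroot // root_formC. Qed.

Lemma half_norm_refl beta gamma : is_root beta -> is_root gamma ->
  half_norm (refl beta gamma) = half_norm gamma.
Proof.
move=> rb rg; set d := refl beta gamma.
have rd : is_root d by apply: (root_refl hC hX).
have /lt0r_neq0 b0 := half_norm_gt0 rb.
set n := wt gamma (hc beta).
have gE : gamma = d + n *: beta by rewrite /d /reflection -/n subrK.
have e1 := half_norm_sym rg rb; rewrite -/n in e1.
have e2 := half_norm_sym rd rb; rewrite (wt_refl hX _ rb) -/n in e2.
have e3 := half_norm_sym rd rg.
rewrite {1}/d /reflection wtB wtZ -/n (wt_coroot hX rg) in e3.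
have gd : wt gamma (hc d) = 2%:R + n * wt beta (hc d).
  by rewrite {1}gE wtD wtZ (wt_coroot hX rd).
rewrite gd in e3; apply: (mulfI b0); apply: (mulfI (_ : 2%:R != 0 :> F)).
  by rewrite pnatr_eq0.
move: e1 e2 e3; move: (wt beta (hc d)) (wt beta (hc gamma)) => q p.
move: (half_norm d) (half_norm gamma) (half_norm beta) => cd cg cb e1 e2 e3.
have -> : 2%:R * (cb * cd) = cb * (cd * (2%:R - n * p)) + n * cd * (cb * p) by ring.
rewrite e3 -e1.
have -> : cb * (cg * (2%:R + n * q)) = 2%:R * (cb * cg) + n * cg * (cb * q) by ring.
by rewrite -e2; ring.
Qed.

Lemma wt_coroot_refl beta gamma : is_root beta -> is_root gamma ->
  wt beta (hc (refl beta gamma)) = - wt beta (hc gamma).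
Proof.
move=> rb rg; have rd : is_root (refl beta gamma) by apply: (root_refl hC hX).
have /lt0r_neq0 b0 := half_norm_gt0 rb; apply: (mulfI b0).
rewrite mulrN -(half_norm_sym rd rb) -(half_norm_sym rg rb).
by rewrite half_norm_refl // (wt_refl hX) // mulrN.
Qed.

Lemma pos_string beta gamma n k : beta \in Dp -> gamma \in Dp ->
  wt gamma (hc beta) = - n%:R -> (k <= n)%N -> gamma + beta *+ k \in Dp.
Proof.
move=> bd gd gn; have rb := pos_root bd; have rg := pos_root gd.
elim: k => [|k IHk] kn; first by rewrite addr0.
have kd := IHk (ltnW kn).
have k0 := pos_add_neq0 kd bd; rewrite mulrSr addrA pos_add //.
rewrite -addrA -mulrSr -[beta]opprK mulNrn.
apply: (root_string hC hX (root_opp hX rb) rg _ kn).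
  by rewrite (coroot_opp hX rb) wtNr gn opprK.
by rewrite mulNrn opprK mulrSr addrA.
Qed.

Lemma refl_nonpos beta gamma : beta \in Dp -> gamma \in Dp ->
  refl beta gamma \notin Dp -> exists n : nat, wt gamma (hc beta) = n.+1%:R.
Proof.
move=> bd gd.
have [z gz] := cartan_integer hC hX (pos_root bd) (pos_root gd).
have neg n : z = - n%:Z -> refl beta gamma \in Dp.
  move=> zn; rewrite zn rmorphN /= in gz.
  rewrite /reflection gz scaleNr opprK scaler_nat.
  exact: (pos_string bd gd gz (leqnn n)).
case: z gz neg => [[|n]|n] gz neg; first by rewrite (neg 0%N).
  by exists n.
by rewrite (neg n.+1) // NegzE.
Qed.

Lemma simple_pos alpha : alpha \in simple_roots Dp -> alpha \in Dp.
Proof. by rewrite mem_filter => /andP[]. Qed.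

Lemma simple_indec alpha beta gamma : alpha \in simple_roots Dp ->
  beta \in Dp -> gamma \in Dp -> alpha != beta + gamma.
Proof.
rewrite mem_filter => /andP[/hasPn ns _] bd gd.
by have /hasPn := ns _ bd; apply.
Qed.

Lemma nonsimple_decomposition alpha : alpha \in Dp -> alpha \notin simple_roots Dp ->
  exists2 beta, beta \in Dp & exists2 gamma, gamma \in Dp & alpha = beta + gamma.
Proof.
move=> ad; rewrite mem_filter ad andbT negbK => /hasP[b bd /hasP[c cd /eqP e]].
by exists b => //; exists c.
Qed.

(* A simple reflection permutes the other positive roots: the string
   gamma, gamma - beta, ... cannot leave Dp, nor meet beta. *)
Lemma simple_refl_pos beta gamma : beta \in simple_roots Dp -> gamma \in Dp ->
  gamma != beta -> refl beta gamma \in Dp.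
Proof.
move=> bs gd gb; have bd := simple_pos bs; apply/negPn/negP => rD.
have [n gn] := refl_nonpos bd gd rD; move: rD; rewrite /reflection gn scaler_nat.
have rb := pos_root bd; have rg := pos_root gd.
suff /(_ n.+1 (leqnn _))[-> //] : forall k, (k <= n.+1)%N ->
  gamma - beta *+ k \in Dp /\ gamma - beta *+ k != beta.
elim=> [|k IHk] kn; first by rewrite subr0.
have [kd kb] := IHk (ltnW kn).
have E : gamma - beta *+ k.+1 = gamma - beta *+ k - beta.
  by rewrite mulrSr opprD addrA.
have k0 : gamma - beta *+ k.+1 != 0 by rewrite E subr_eq0.
have rk := root_string hC hX rb rg gn kn k0.
rewrite {k0}E in rk *; split.
  apply/negPn/negP => nD; have := pos_or_opp rk nD; rewrite opprB => od.
  by have := simple_indec bs kd od; rewrite addrC subrK eqxx.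
rewrite subr_eq -mulr2n; apply: contraTneq (pos_root kd) => ->.
exact: (double_nonroot hC hX).
Qed.

Definition half_coroot_sum : subvs_of h := 2%:R^-1 *: \sum_(alpha <- Dp) hc alpha.
Local Notation A := half_coroot_sum.

Lemma wt_half_coroot_sum beta : beta \in Dp -> wt beta A =
  2%:R^-1 * \sum_(gamma <- [seq gamma <- Dp | refl beta gamma \notin Dp])
     wt beta (hc gamma).
Proof.
move=> bd; rewrite wtZr wt_sumr; congr (_ * _); rewrite big_filter.
have rb := pos_root bd.
rewrite (bigID (fun gamma => refl beta gamma \in Dp)) /= -big_filter.
set Q := [seq _ <- _ | _]; set S := \sum_(i <- Q) _.
suff -> : S = 0 by rewrite add0r.
have pQ : perm_eq (map (refl beta) Q) Q.
  apply: perm_map_self; first exact: (filter_uniq _ pos_uniq).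
    exact: in2W (can_inj (fun zeta => reflK hX zeta rb)).
  by move=> u; rewrite !mem_filter (reflK hX _ rb) => /andP[-> ->].
have SN : S = - S.
  rewrite {1}/S -(perm_big _ pQ) big_map /S -sumrN big_seq [RHS]big_seq.
  apply: eq_bigr => u; rewrite mem_filter => /andP[_ /pos_root ru].
  exact: wt_coroot_refl.
by apply/eqP; rewrite -eqNr -SN.
Qed.

Lemma refl_self beta : is_root beta -> refl beta beta = - beta.
Proof.
move=> rb; rewrite /reflection (wt_coroot hX rb) scaler_nat mulr2n opprD.
by rewrite addrA subrr add0r.
Qed.

Lemma wt_half_coroot_sum_gt0 beta : beta \in Dp -> 0 < wt beta A.
Proof.
move=> bd; have rb := pos_root bd.
rewrite wt_half_coroot_sum // mulr_gt0 ?invr_gt0 ?ltr0n //.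
have pos gamma : gamma \in [seq gamma <- Dp | refl beta gamma \notin Dp] ->
    0 < wt beta (hc gamma).
  rewrite mem_filter => /andP[nD gd]; have rg := pos_root gd.
  have [n gn] := refl_nonpos bd gd nD.
  rewrite -(pmulr_rgt0 _ (half_norm_gt0 rb)) half_norm_sym //.
  by rewrite gn mulr_gt0 ?half_norm_gt0 ?ltr0n.
have bQ : beta \in [seq gamma <- Dp | refl beta gamma \notin Dp].
  by rewrite mem_filter bd refl_self ?pos_opp.
rewrite (bigD1_seq beta) ?filter_uniq ?pos_uniq //=.
apply: ltr_pwDl; first exact: pos.
by rewrite big_seq_cond; apply: sumr_ge0 => u /andP[/pos/ltW].
Qed.

Lemma wt_half_coroot_sum_simple beta : beta \in simple_roots Dp -> wt beta A = 1.
Proof.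
move=> bs; have bd := simple_pos bs; have rb := pos_root bd.
rewrite wt_half_coroot_sum // (bigD1_seq beta) ?filter_uniq ?pos_uniq //=.
  rewrite (wt_coroot hX rb) big_seq_cond big1 ?addr0 ?mulVf ?pnatr_eq0 // => u.
  by rewrite mem_filter -andbA => /and3P[+ ud ub]; rewrite simple_refl_pos.
by rewrite mem_filter bd refl_self ?pos_opp.
Qed.

Lemma height_nat beta : beta \in Dp -> exists n : nat, wt beta A = n.+1%:R.
Proof.
pose lower b := count (fun d => wt d A < wt b A) Dp.
have [m] := ubnP (lower beta); elim: m beta => // m IHm beta /ltnSE bm bd.
have [bs|ns] := boolP (beta \in simple_roots Dp).
  by exists 0%N; rewrite wt_half_coroot_sum_simple.
have [b bD [c cD e]] := nonsimple_decomposition bd ns.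
have IH u v : u \in Dp -> v \in Dp -> beta = u + v ->
    exists n : nat, wt u A = n.+1%:R.
  move=> uD vD buv; have lt : wt u A < wt beta A.
    by rewrite buv wtD ltrDl wt_half_coroot_sum_gt0.
  apply: IHm => //; apply: leq_trans bm; rewrite /lower.
  rewrite -!size_filter; apply: (@uniq_leq_size _ (u :: _)) => [|d].
    by rewrite /= mem_filter ltxx /= filter_uniq ?pos_uniq.
  rewrite inE => /predU1P[->|]; rewrite !mem_filter ?uD ?lt // => /andP[du ->].
  by rewrite (lt_trans du lt).
have [n bn] := IH b c bD cD e.
have [k ck] := IH c b cD bD (etrans e (addrC _ _)).
by exists (n + k.+1)%N; rewrite e wtD bn ck -natrD addSn.
Qed.

Lemma height1_simple beta : beta \in Dp -> wt beta A = 1 -> beta \in simple_roots Dp.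
Proof.
move=> bd b1; apply/negPn/negP => ns.
have [b bD [c cD e]] := nonsimple_decomposition bd ns.
have [[n bn] [k ck]] := (height_nat bD, height_nat cD).
move: b1; rewrite e wtD bn ck -natrD => /eqP.
by rewrite (eqr_nat F _ 1) addSn addnS.
Qed.

Lemma weight_space_sum H c v : ⁅vsval H, v⁆ = c *: v ->
  v \in rootspace_sum [seq alpha <- 0 :: all_roots | wt alpha H == c].
Proof.
move=> Hv; pose s := [seq wt alpha H | alpha <- 0 :: all_roots & wt alpha H != c].
set U := rootspace_sum _.
have /(_ v) : forall u, ad_prod (vsval H) s u \in U.
  move=> u; set V := rootspace_sum (0 :: all_roots).
  have : u \in V.
    have -> : V = fullv; last exact: memvf.
    apply: (weight_decomposition hC) => alpha; apply/subvP => w wa.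
    have [a0|a0] := boolP (alpha \in 0 :: all_roots); first exact: (memv_sum_seq a0).
    rewrite inE mem_all_roots negb_or in a0; case/andP: a0 => a0 ra.
    by have -> := rootspace_nonroot a0 ra wa; apply: mem0v.
  move: u; apply: memv_sum_ind => [|u w uU wU|alpha u aD ua].
  - by rewrite ad_prod0 mem0v.
  - by rewrite ad_prodD memvD.
  rewrite (ad_prod_eigen _ (lie_rootspace H ua)).
  have [ac|ac] := eqVneq (wt alpha H) c.
    by rewrite memvZ // (memv_sum_seq _ ua) // mem_filter ac eqxx.
  rewrite (_ : \prod_(b <- s) _ = 0) ?scale0r ?mem0v //; apply/eqP.
  rewrite prodf_seq_eq0; apply/hasP; exists (wt alpha H); rewrite /= ?subrr //.
  by apply/mapP; exists alpha; rewrite // mem_filter ac.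
rewrite (ad_prod_eigen _ Hv) => kv.
have k0 : \prod_(b <- s) (c - b) != 0.
  rewrite prodf_seq_neq0; apply/allP => _ /mapP[a + ->] /=.
  by rewrite mem_filter subr_eq0 eq_sym => /andP[].
by rewrite -[v]scale1r -(mulVf k0) -scalerA memvZ.
Qed.

Lemma rootspace_sum_sub (S T : seq (dual_of h)) :
  {subset S <= T} -> (rootspace_sum S <= rootspace_sum T)%VS.
Proof.
move=> ST; apply/subvP; apply: memv_sum_ind => [|u v|a v /ST aT va].
- exact: mem0v.
- exact: memvD.
- exact: memv_sum_seq aT va.
Qed.

Lemma height1_root alpha : is_root alpha -> wt alpha A = 1 ->
  alpha \in simple_roots Dp.
Proof.
move=> ra a1; have [ad|aD] := boolP (alpha \in Dp); first exact: height1_simple.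
have := wt_half_coroot_sum_gt0 (pos_or_opp ra aD).
by rewrite wtN a1 oppr_gt0 ltr10.
Qed.

Lemma eigenspace1 v : ⁅vsval A, v⁆ = v -> v \in rootspace_sum (simple_roots Dp).
Proof.
move=> Av; have /weight_space_sum : ⁅vsval A, v⁆ = 1 *: v by rewrite scale1r.
apply: subvP; apply: rootspace_sum_sub => a.
rewrite mem_filter inE mem_all_roots => /andP[/eqP a1 /predU1P[a0|ra]].
  by move: a1; rewrite a0 wt0 => /esym/eqP; rewrite oner_eq0.
exact: height1_root.
Qed.

Lemma eigenspaceN1 v : ⁅vsval A, v⁆ = - v ->
  v \in rootspace_sum (map -%R (simple_roots Dp)).
Proof.
move=> Av; have /weight_space_sum : ⁅vsval A, v⁆ = (-1) *: v by rewrite scaleN1r.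
apply: subvP; apply: rootspace_sum_sub => a.
rewrite mem_filter inE mem_all_roots => /andP[/eqP a1 /predU1P[a0|ra]].
  by move: a1; rewrite a0 wt0 => /esym/eqP; rewrite oppr_eq0 oner_eq0.
rewrite -[a]opprK map_f // height1_root ?(root_opp hX) //.
by rewrite wtN a1 opprK.
Qed.
End PositiveSystem.

(** * The principal subalgebra and the involution *)

Section Principal.
Context {F : numFieldType} {g : lieAlgType F} {h : {vspace g}}.
Context {x : dual_of h -> g} {hc : dual_of h -> subvs_of h}.
Context {Dp : seq (dual_of h)} {q : dual_of h -> F}.
Context (hC : cartan_subalgebra h) (hX : sl2_system x hc).
Context (hP : positive_roots Dp).
Implicit Types (alpha beta : dual_of h).

Local Notation A := (@half_coroot_sum _ _ _ hc Dp).
Let X := \sum_(alpha <- simple_roots Dp) q alpha *: x alpha.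
Let Y := \sum_(alpha <- simple_roots Dp) q alpha *: x (- alpha).

Context (hA : A = \sum_(alpha <- simple_roots Dp) q alpha ^+ 2 *: hc alpha).

Lemma simple_root_root alpha : alpha \in simple_roots Dp -> is_root alpha.
Proof. by move/simple_pos/(pos_root hP). Qed.

Lemma lie_half_coroot_sum_X : ⁅vsval A, X⁆ = X.
Proof.
rewrite lie_sumr big_seq [RHS]big_seq; apply: eq_bigr => alpha sa.
have xa := sl2s_mem hX (simple_root_root sa).
rewrite lieZr (lie_rootspace _ xa).
by rewrite (wt_half_coroot_sum_simple hC hX hP sa) scale1r.
Qed.

Lemma lie_half_coroot_sum_Y : ⁅vsval A, Y⁆ = - Y.
Proof.
rewrite lie_sumr big_seq /Y -sumrN [RHS]big_seq; apply: eq_bigr => alpha sa.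
have xa := sl2s_mem hX (root_opp hX (simple_root_root sa)).
rewrite lieZr (lie_rootspace _ xa).
by rewrite wtN (wt_half_coroot_sum_simple hC hX hP sa) scaleN1r scalerN.
Qed.

Lemma simple_sub_nonroot alpha beta :
  alpha \in simple_roots Dp -> beta \in simple_roots Dp ->
  ~~ is_root (alpha - beta).
Proof.
move=> sa sb; apply/negP => rab.
have [ad|nd] := boolP (alpha - beta \in Dp).
  by have := simple_indec sa (simple_pos sb) ad; rewrite addrC subrK eqxx.
have := pos_or_opp hP rab nd; rewrite opprB => bd.
by have := simple_indec sb (simple_pos sa) bd; rewrite addrC subrK eqxx.
Qed.

Lemma lie_XY : ⁅X, Y⁆ = - vsval A.
Proof.
rewrite hA lie_suml linear_sum -sumrN big_seq [RHS]big_seq.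
apply: eq_bigr => alpha sa; have ra := simple_root_root sa.
rewrite lieZl lie_sumr (bigD1_seq alpha) ?filter_uniq ?(pos_uniq hP) //=.
rewrite lieZr (sl2s_opp hX ra) big_seq_cond big1 => [|beta /andP[sb ab]].
  by rewrite addr0 !scalerN scalerA -expr2.
rewrite lieZr (_ : ⁅_, _⁆ = 0) ?scaler0 //.
apply: (@rootspace_nonroot _ _ _ (alpha - beta)).
- by rewrite subr_eq0 eq_sym.
- exact: simple_sub_nonroot.
apply: lie_in_rootspace; first exact: (sl2s_mem hX ra).
exact: (sl2s_mem hX (root_opp hX (simple_root_root sb))).
Qed.

Lemma principal_sl2 : sl2_triple X (- 2%:R *: Y) (vsval (2%:R *: A)).
Proof.
split.
- by rewrite lieZr lie_XY scaleNr scalerN opprK [RHS]linearZ.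
- by rewrite lie_vsvalZ lie_half_coroot_sum_X.
- rewrite lieZr lie_vsvalZ lie_half_coroot_sum_Y; congr (_ *: _).
  by rewrite scalerN scaleNr.
exact: cartan_weights.
Qed.

Context {sigma : 'End(g)}.
Context (sigma_aut : lie_automorphism sigma).
Context (sigma_ker : {in lker (ad X), forall z, sigma z = - z}).
Context (sigmaY : sigma Y = - Y).

Lemma sigma_lie u v : sigma ⁅u, v⁆ = ⁅sigma u, sigma v⁆.
Proof. by case: sigma_aut. Qed.

Lemma sigma_kerX z : ⁅X, z⁆ = 0 -> sigma z = - z.
Proof. by move=> Xz; apply: sigma_ker; rewrite memv_ker adE Xz. Qed.

Lemma sigmaX : sigma X = - X.
Proof. by apply: sigma_kerX; rewrite liexx. Qed.

Lemma sigmaA : sigma (vsval A) = vsval A.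
Proof.
rewrite -[vsval A]opprK -lie_XY linearN /= sigma_lie sigmaX sigmaY.
by rewrite lieNl lieNr opprK.
Qed.

Lemma sigma_eigen c v : ⁅vsval A, v⁆ = c *: v -> ⁅vsval A, sigma v⁆ = c *: sigma v.
Proof. by move=> Av; rewrite -[in LHS]sigmaA -sigma_lie Av linearZ. Qed.

Lemma sigma_iterX n v :
  sigma (iter n (lie X) v) = (-1) ^+ n *: iter n (lie X) (sigma v).
Proof.
elim: n => [|n IHn]; first by rewrite scale1r.
by rewrite iterS sigma_lie IHn sigmaX lieNl lieZr -scaleN1r scalerA -exprS.
Qed.

(* If y has lowest weight - n, then X^(2n) y lies in ker (ad X), where sigma is
   -1; as X^(2n) commutes with sigma and is injective on the weight space of y,
   sigma y = - y. *)
Lemma sigma_lowest n y : ⁅Y, y⁆ = 0 -> ⁅vsval A, y⁆ = - n%:R *: y ->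
  sigma y = - y.
Proof.
move=> Yy Ay; have tr := principal_sl2; have tr' := sl2_opp tr.
have kE v : ⁅vsval A, v⁆ = - n%:R *: v ->
    ⁅- vsval (2%:R *: A), v⁆ = (n.*2)%:R *: v.
  move=> Av; rewrite lieNl lie_vsvalZ Av scaleNr scalerN opprK scalerA.
  by rewrite -natrM mul2n.
have top : ⁅X, iter n.*2 (lie X) y⁆ = 0.
  rewrite -iterS; set w := iter _ _ _.
  apply: (@sl2_lower_inj _ _ _ _ _ w n.*2.+2 tr).
    rewrite /w (sl2_weight_iter n.*2.+1 (sl2_ke tr) (c := - (n.*2)%:R)).
      congr (_ *: _); rewrite -!natrM -[n.*2.+2]addn2 -addnn -addn1 !natrD.
      by rewrite !natrM !natrD; ring.
    by rewrite -[LHS]opprK -lieNl kE // scaleNr.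
  have Yw : ⁅- 2%:R *: Y, w⁆ = 0.
    rewrite /w (sl2_commute n.*2 tr' (kE _ Ay)) subrr mulr0 scale0r addr0.
    by rewrite lieZl Yy scaler0 iter_lie0.
  by rewrite iterSr Yw iter_lie0.
apply/eqP; rewrite -addr_eq0; apply/eqP.
apply: (@sl2_lower_inj _ _ _ _ _ _ n.*2 tr').
  by rewrite linearD /= (kE _ (sigma_eigen Ay)) (kE _ Ay) scalerDr.
have := sigma_kerX top; rewrite sigma_iterX -signr_odd odd_double scale1r => e.
have D u v k : iter k (lie X) (u + v) = iter k (lie X) u + iter k (lie X) v.
  by elim: k => //= k ->; rewrite linearD.
by rewrite D e addNr.
Qed.

Context {eta : dual_of h} (hE : longest_root Dp eta).

Lemma sigma_highest_space y : y \in rootspace eta -> sigma y = - y.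
Proof.
case: hE => ed eN ye; apply: sigma_kerX.
rewrite lie_suml big_seq big1 // => alpha sa.
have ad := simple_pos sa.
rewrite lieZl (_ : ⁅_, _⁆ = 0) ?scaler0 //.
apply: (@rootspace_nonroot _ _ _ (alpha + eta)).
- exact: (pos_add_neq0 hP).
- exact: eN.
exact: lie_in_rootspace (sl2s_mem hX (simple_root_root sa)) ye.
Qed.

Lemma sigma_lowest_space y : y \in rootspace (- eta) -> sigma y = - y.
Proof.
case: hE => ed eN ye; have [n en] := height_nat hC hX hP ed.
apply: (@sigma_lowest n.+1); last by rewrite (lie_rootspace _ ye) wtN en.
rewrite lie_suml big_seq big1 // => alpha sa.
have ad := simple_pos sa.
rewrite lieZl (_ : ⁅_, _⁆ = 0) ?scaler0 //.
apply: (@rootspace_nonroot _ _ _ (- alpha + - eta)).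
- by rewrite -opprD oppr_eq0 (pos_add_neq0 hP).
- by rewrite -opprD; apply: contra (eN _ ad) => /(root_opp hX); rewrite opprK.
exact: lie_in_rootspace (sl2s_mem hX (root_opp hX (simple_root_root sa))) ye.
Qed.

Lemma sigma_coroot : sigma (vsval (hc eta)) = vsval (hc eta).
Proof.
case: hE => /(pos_root hP) re _.
rewrite -[vsval _]opprK -(sl2s_opp hX re) linearN /= sigma_lie.
rewrite (sigma_highest_space (sl2s_mem hX re)).
by rewrite (sigma_lowest_space (sl2s_mem hX (root_opp hX re))) lieNl lieNr opprK.
Qed.

Lemma limg_sigma (U : {vspace g}) :
  (forall v, v \in U -> sigma v \in U) -> (sigma @: U)%VS = U.
Proof.
move=> sU; apply/eqP; rewrite eqEdim; apply/andP; split.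
  by apply/subvP => _ /memv_imgP[v vU ->]; apply: sU.
rewrite limg_dim_eq //; have -> : lker sigma = 0%VS; last exact: capv0.
by apply/eqP/lker0P; case: sigma_aut => /bij_inj.
Qed.

Lemma limg_sigma_Zdagger :
  (sigma @: rootspace_sum (Zdagger Dp eta))%VS = rootspace_sum (Zdagger Dp eta).
Proof.
apply: limg_sigma; apply: memv_sum_ind => [|u v|alpha v].
- by rewrite linear0 mem0v.
- by rewrite linearD; apply: memvD.
rewrite inE => /predU1P[->|sa] va.
  by rewrite sigma_lowest_space // memvN (memv_sum_seq _ va) ?mem_head.
have : sigma v \in rootspace_sum (simple_roots Dp).
  apply: (eigenspace1 hC hX hP); rewrite -[RHS]scale1r; apply: sigma_eigen.
  by rewrite (lie_rootspace _ va) (wt_half_coroot_sum_simple hC hX hP sa).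
apply: subvP; apply: rootspace_sum_sub => b bs.
by rewrite inE bs orbT.
Qed.

Lemma limg_sigma_Zroots :
  (sigma @: rootspace_sum (Zroots Dp eta))%VS = rootspace_sum (Zroots Dp eta).
Proof.
apply: limg_sigma; apply: memv_sum_ind => [|u v|alpha v].
- by rewrite linear0 mem0v.
- by rewrite linearD; apply: memvD.
rewrite /Zroots /= opprK inE => /predU1P[->|/mapP[b sb ->]] va.
  by rewrite sigma_highest_space // memvN (memv_sum_seq _ va) ?mem_head.
have : sigma v \in rootspace_sum (map -%R (simple_roots Dp)).
  apply: (eigenspaceN1 hC hX hP); rewrite -scaleN1r; apply: sigma_eigen.
  by rewrite (lie_rootspace _ va) wtN (wt_half_coroot_sum_simple hC hX hP sb).
apply: subvP; apply: rootspace_sum_sub => c cs.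
by rewrite inE cs orbT.
Qed.
End Principal.

Theorem proposition2p5p4 (R : realType) (g : lieAlgType R[i])
    (h : {vspace g}) (Dp : seq (dual_of h))
    (x : dual_of h -> g) (hc : dual_of h -> subvs_of h)
    (r : dual_of h -> R[i]) (sigma : 'End(g)) (eta : dual_of h) :
  lie_simple g ->
  cartan_subalgebra h ->
  positive_roots Dp ->
  chevalley_base x hc ->
  principal_coefficients Dp hc r ->
  kostant_hitchin_involution Dp x r sigma ->
  longest_root Dp eta ->
  [/\ sigma (x eta) = - x eta,
      sigma (vsval (hc eta)) = vsval (hc eta),
      (sigma @: rootspace_sum (Zroots Dp eta))%VS
        = rootspace_sum (Zroots Dp eta)
    & (sigma @: rootspace_sum (Zdagger Dp eta))%VS
        = rootspace_sum (Zdagger Dp eta)].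
Proof.
move=> _ hC hP hX hr [aut ker sY] hE.
have hX' : sl2_system x hc.
  by split; [apply: chev_mem hX|apply: chev_neq0 hX|apply: chev_coroot hX
            |apply: chev_opp hX].
have hA : @half_coroot_sum _ _ _ hc Dp
    = \sum_(alpha <- simple_roots Dp) sqrtC (r alpha) ^+ 2 *: hc alpha.
  by rewrite /half_coroot_sum hr; apply: eq_bigr => alpha _; rewrite sqrtCK.
split.
- apply: (sigma_highest_space hX' hP ker hE); apply: (sl2s_mem hX').
  by case: hE => /(pos_root hP).
- exact: (sigma_coroot hC hX' hP hA aut ker sY hE).
- exact: (limg_sigma_Zroots hC hX' hP hA aut ker sY hE).
- exact: (limg_sigma_Zdagger hC hX' hP hA aut ker sY hE).
Qed.
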